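(* Consider the exploration history model of linear search, in which the robot moves with speed $1$ over parts of the line it has not yet explored and with speed $s>1$ over parts of the line it has already explored. Let $r=1+\sqrt{2/(s+1)}$ and let $X=(r^0,r^1,r^2,\ldots)$. Then the zig-zag search with strategy $X$ satisfies $$2+\frac1s \le \sigma^* \le \sigma_X = 2+\frac1s\left(3+2\sqrt{2s+2}\right).$$
   Context: A robot starts at the origin of the real line and searches for a stationary target at an unknown point at distance $d$ from the origin (on either side). A zig-zag strategy is an infinite sequence $X=\{x_k\}_{k\ge1}$ of positive reals with $x_k<x_{k+2}$ for all $k$; the zig-zag search with strategy $X$ proceeds in rounds $k=1,2,\dots$: in an odd (resp. even) round the robot moves right (resp. left) from the origin a distance $x_k$, stopping if it reaches the target, and otherwise turns and returns to the origin. $\sigma_X(d)$ denotes the ratio between the time the robot using $X$ needs to reach a target at distance $d$ (worst case over the target being at $+d$ or $-d$) and the time an omniscient robot, knowing the target's location and obeying the same movement rules, needs to travel from the origin directly to the target. The competitive ratio is $\sigma_X=\sup_{d>1}\sigma_X(d)$, and $\sigma^*$ denotes the optimal (infimum over all strategies) competitive ratio. *)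

(* Defs.v *)
From HB Require Import structures.
From mathcomp Require Import all_boot all_order all_algebra.
From mathcomp Require Import all_classical all_reals ereal.

Set Implicit Arguments.
Unset Strict Implicit.
Unset Printing Implicit Defensive.

Import Order.TTheory GRing.Theory Num.Theory.

Local Open Scope classical_set_scope.
Local Open Scope ring_scope.

(* Strategies are indexed from 0: [X k] stands for x_{k+1}.  Hence the
   rounds with an even index go right and those with an odd index go left. *)
Definition zigzag_strategy (R : realType) (X : nat -> R) : Prop :=
  (forall k, 0 < X k) /\ (forall k, X k < X k.+2).

Definition goes_right (k : nat) : bool := ~~ odd k.

(* Time to move from the origin to distance y on one side of the line, when
   exactly the points at distance at most e are already explored on that side:
   the first min(y, e) is travelled at speed s, the rest at speed 1. *)
Definition outbound_time (R : realType) (s e y : R) : R :=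
  Num.min y e / s + Num.max (y - e) 0.

(* The distance explored, when round k starts, on the side round k visits. *)
Definition explored (R : realType) (X : nat -> R) (k : nat) : R :=
  \big[Num.max/0]_(j < k | goes_right j == goes_right k) X j.

(* The way back to the origin lies entirely in explored territory. *)
Definition round_time (R : realType) (s : R) (X : nat -> R) (k : nat) : R :=
  outbound_time s (explored X k) (X k) + X k / s.

(* Whether the target at distance d, to the right iff b, is reached by round k. *)
Definition reaches (R : realType) (X : nat -> R) (b : bool) (d : R) (k : nat) :
    bool :=
  (goes_right k == b) && (d <= X k).

Definition first_reaches (R : realType) (X : nat -> R) (b : bool) (d : R)
    (k : nat) : Prop :=
  reaches X b d k /\ (forall j, (j < k)%N -> ~~ reaches X b d j).

(* The set below has at most one element; it is empty exactly when the target is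
   never reached, and then the infimum is +oo. *)
Definition search_time (R : realType) (s : R) (X : nat -> R) (b : bool) (d : R) :
    \bar R :=
  ereal_inf [set (\sum_(j < k) round_time s X j
                  + outbound_time s (explored X k) d)%:E
            | k in [set k | first_reaches X b d k]].

(* An omniscient robot goes straight to the target, on an unexplored line. *)
Definition omniscient_time (R : realType) (s d : R) : R := outbound_time s 0 d.

Definition ratio_at (R : realType) (s : R) (X : nat -> R) (d : R) : \bar R :=
  (maxe (search_time s X true d) (search_time s X false d)
     / (omniscient_time s d)%:E)%E.

Definition competitive_ratio (R : realType) (s : R) (X : nat -> R) : \bar R :=
  ereal_sup [set ratio_at s X d | d in [set d | 1 < d]].

Definition optimal_ratio (R : realType) (s : R) : \bar R :=
  ereal_inf [set competitive_ratio s X | X in [set X | zigzag_strategy X]].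

(* Main.v *)
(* Summing the round times, a target at distance d first reached in round k + 1
   costs (1 - 1/s) x_k + (2/s) (x_0 + ... + x_k) + d.  On the side explored
   last, x_k >= d, which gives the lower bound 2 + 1/s at every d.  For
   x_k = r^k the supremum of the ratio is 1 + (1 - 1/s) r + (2/s) r^2/(r - 1),
   approached by targets just beyond late turning points; with r = 1 + t and
   (s + 1) t^2 = 2 this is the stated value. *)
Require Import Defs.
From mathcomp Require Import all_boot all_order all_algebra.
From mathcomp Require Import all_classical all_reals ereal.
From mathcomp Require Import ring lra.
Set Implicit Arguments.
Unset Strict Implicit.

Import Order.TTheory GRing.Theory Num.Theory.
Local Open Scope ring_scope.

(** * Powers, geometric sums and division in the extended reals *)

Lemma expr_unbounded (R : realType) (a r : R) : 1 < r -> exists n, a < r ^+ n.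
Proof.
move=> r1.
have bernoulli n : n%:R * (r - 1) <= r ^+ n.
  elim: n => [|n IHn]; first by rewrite mul0r.
  have rn1 : 1 <= r ^+ n by apply: exprn_ege1; exact: ltW.
  rewrite -natr1 exprS; nra.
exists (Num.trunc (a / (r - 1))).+1; apply: lt_le_trans (bernoulli _).
by rewrite -ltr_pdivrMr ?subr_gt0// truncnS_gt.
Qed.

Lemma sum_expr (R : realFieldType) (r : R) (n : nat) :
  r != 1 -> \sum_(j < n) r ^+ j = (r ^+ n - 1) / (r - 1).
Proof. by move=> r1; rewrite subrX1 mulrC mulKf// subr_eq0. Qed.

(** The numerator is extended because a search time may be [+oo]. *)
Lemma lee_pdivlMr_EFin (R : realType) (c d : R) (x : \bar R) : 0 < d ->
  (c%:E <= x / d%:E)%E = ((c * d)%:E <= x)%E.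
Proof.
move=> d0; rewrite inver gt_eqF//; case: x => [x| |].
- by rewrite -EFinM !lee_fin ler_pdivlMr.
- by rewrite mulyr gtr0_sg ?invr_gt0// mul1e !leey.
- by rewrite mulNyr gtr0_sg ?invr_gt0// mul1e !leeNy_eq.
Qed.

Lemma lee_pdivrMr_EFin (R : realType) (c d : R) (x : \bar R) : 0 < d ->
  (x / d%:E <= c%:E)%E = (x <= (c * d)%:E)%E.
Proof.
move=> d0; rewrite inver gt_eqF//; case: x => [x| |].
- by rewrite -EFinM !lee_fin ler_pdivrMr.
- by rewrite mulyr gtr0_sg ?invr_gt0// mul1e !leye_eq.
- by rewrite mulNyr gtr0_sg ?invr_gt0// mul1e !leNye.
Qed.

(** * Search times of an arbitrary strategy *)

Section LinearSearch.
Variables (R : realType) (s : R) (X : nat -> R).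

Lemma outbound_time_ge (e y : R) : e <= y -> outbound_time s e y = e / s + (y - e).
Proof. by move=> ey; rewrite /outbound_time min_r// max_l// subr_ge0. Qed.

Lemma first_reaches_inj b d j k :
  first_reaches X b d j -> first_reaches X b d k -> j = k.
Proof.
move=> [rj Hj] [rk Hk]; case: (ltngtP j k) => // jk.
- by move: (Hk _ jk); rewrite rj.
- by move: (Hj _ jk); rewrite rk.
Qed.

Lemma first_reaches_ex b d k :
  reaches X b d k -> exists j, first_reaches X b d j.
Proof.
move=> rk; have exk : exists j, reaches X b d j by exists k.
case: (ex_minnP exk) => m rm minm; exists m; split => // j jm.
by apply/negP => /minm; rewrite leqNgt jm.
Qed.

Lemma search_time_first b d k : first_reaches X b d k ->
  search_time s X b d
  = (\sum_(j < k) round_time s X j + outbound_time s (explored X k) d)%:E.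
Proof.
move=> rk; rewrite /search_time; set F := fun k => _.
suff -> : [set k | first_reaches X b d k]%classic = [set k]%classic.
  by rewrite image_set1 ereal_inf1.
apply/seteqP; split => j /=; first by move=> /first_reaches_inj; apply.
by move=> ->.
Qed.

Lemma search_time_never b d :
  (forall k, ~ first_reaches X b d k) -> search_time s X b d = +oo%E.
Proof.
move=> nr; rewrite /search_time.
suff -> : [set k | first_reaches X b d k]%classic = set0.
  by rewrite image_set0 ereal_inf0.
by apply/seteqP; split => j //= /nr.
Qed.

(** An earlier round on the same side going as far as [d] would already have met the target. *)
Lemma explored_lt_first b d k :
  0 < d -> first_reaches X b d k -> explored X k < d.
Proof.
move=> d0 [/andP[/eqP kb _] minr]; rewrite /explored.
apply: bigmax_lt => // j /eqP jk; rewrite ltNge; apply/negP => dX.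
by move: (minr j (ltn_ord j)); rewrite /reaches jk kb eqxx dX.
Qed.

Lemma ratio_atE d : 0 < d ->
  ratio_at s X d
  = (maxe (search_time s X true d) (search_time s X false d) / d%:E)%E.
Proof.
move=> d0; rewrite /ratio_at /omniscient_time outbound_time_ge ?ltW//.
by rewrite mul0r add0r subr0.
Qed.

Hypothesis zX : zigzag_strategy X.

Lemma strategy_le j k : (j <= k)%N -> odd j = odd k -> X j <= X k.
Proof.
move=> jk ojk.
have -> : k = (j + (k - j)./2.*2)%N.
  have := odd_double_half (k - j).
  by rewrite oddB// ojk addbb add0n => ->; rewrite subnKC.
elim: (_./2) => [|m IHm]; first by rewrite addn0.
by rewrite doubleS !addnS; apply: le_trans IHm (ltW _); apply: zX.2.
Qed.

Lemma explored0 : explored X 0 = 0.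
Proof. by rewrite /explored big_ord0. Qed.

Lemma explored1 : explored X 1 = 0.
Proof. by rewrite /explored big_pred0// => j; rewrite ord1. Qed.

(** Turning points increase on each side, so the maximum is the last one there; round [k.+1] is
    excluded by parity. *)
Lemma exploredSS k : explored X k.+2 = X k.
Proof.
apply/eqP; rewrite eq_le; apply/andP; split.
  apply: bigmax_le => [|j /eqP]; first exact: ltW (zX.1 k).
  rewrite /goes_right /= negbK => /negb_inj ojk.
  apply: strategy_le => //; have := ltn_ord j.
  rewrite ltnS leq_eqVlt ltnS => /orP[/eqP jk|//].
  by move: ojk; rewrite jk /=; case: odd.
have k2 : (k < k.+2)%N by rewrite ltnS leqnSn.
rewrite /explored.
apply: (@le_bigmax_cond _ _ _ _ (Ordinal k2) _ (fun i : 'I_k.+2 => X i)).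
by rewrite /goes_right /= negbK.
Qed.

Lemma explored_le k : explored X k <= X k.
Proof.
case: k => [|[|k]].
- by rewrite explored0 ltW// zX.1.
- by rewrite explored1 ltW// zX.1.
- by rewrite exploredSS ltW// zX.2.
Qed.

(** With [e = explored X k.+1], reaching [d] in round [k.+1] takes [e / s + d - e] outbound, so the
    left side is the search time minus [d]. Adding that round cancels the [e] terms, and the next
    explored distance, [X k], cancels the old [(1 - s^-1) * X k]. *)
Lemma sum_round_time k :
  \sum_(j < k.+1) round_time s X j + explored X k.+1 / s - explored X k.+1
  = (1 - s^-1) * X k + 2 / s * \sum_(j < k.+1) X j.
Proof.
elim: k => [|k IHk].
  rewrite !big_ord_recl !big_ord0 explored1 /round_time explored0.
  by rewrite outbound_time_ge ?ltW ?zX.1//; ring.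
rewrite big_ord_recr [in RHS]big_ord_recr /= exploredSS [round_time s X k.+1]/round_time.
rewrite outbound_time_ge ?explored_le//.
rewrite mulrDr; move: IHk; set S := \sum_(j < _) _; set T := \sum_(j < _) _.
by lra.
Qed.

Lemma search_time_firstS b d k : 0 < d -> first_reaches X b d k.+1 ->
  search_time s X b d
  = ((1 - s^-1) * X k + 2 / s * \sum_(j < k.+1) X j + d)%:E.
Proof.
move=> d0 rk; rewrite (search_time_first rk) -sum_round_time.
rewrite outbound_time_ge ?(ltW (explored_lt_first d0 rk))//.
by congr _%:E; ring.
Qed.

(** * The lower bound at every distance *)

Hypothesis s1 : 1 < s.

Lemma search_time_second_side b d j k : 0 < d ->
  first_reaches X b d k -> first_reaches X (~~ b) d j -> (j < k)%N ->
  (((2 + 1 / s) * d)%:E <= search_time s X b d)%E.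
Proof.
case: k => // k d0 rk rj; rewrite ltnS => jk.
have s0 : 0 < s^-1 by rewrite invr_gt0 (lt_trans ltr01 s1).
have s1' : s^-1 < 1 by rewrite invf_lt1 ?(lt_trans ltr01 s1).
(* Rounds [j] and [k] are on the same side, opposite to [b], so the later one goes at least as
   far. *)
have dXk : d <= X k.
  case: rj rk => /andP[/eqP jb dX] _ [/andP[/eqP kb _] _].
  apply: le_trans dX (strategy_le jk _).
  by move: jb; rewrite -kb /goes_right /= negbK => /negb_inj.
rewrite (search_time_firstS d0 rk) lee_fin big_ord_recr /=.
(* Keeping only the last term of the sum leaves [(1 - 1/s) d + (2/s) d + d]. *)
have : 0 <= \sum_(i < k) X i by apply: sumr_ge0 => i _; rewrite ltW// zX.1.
set S := \sum_(i < k) _ => S0; nra.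
Qed.

(** The side reached later supplies the bound; a side never reached makes the ratio infinite, and
    parity rules out a common round. *)
Lemma ratio_at_ge d : 0 < d -> ((2 + 1 / s)%:E <= ratio_at s X d)%E.
Proof.
move=> d0; rewrite ratio_atE// lee_pdivlMr_EFin// le_max.
have [[k rk]|/forallNP/search_time_never ->] :=
  pselect (exists k, first_reaches X true d k); last by rewrite leey.
have [[j rj]|/forallNP/search_time_never ->] :=
  pselect (exists j, first_reaches X false d j); last by rewrite leey orbT.
case: (ltngtP j k) => jk.
- by rewrite (search_time_second_side d0 rk rj).
- by rewrite (search_time_second_side d0 rj rk)// orbT.
- by case: rk rj => /andP[/eqP + _] _ [/andP[/eqP + _] _]; rewrite jk => ->.
Qed.

End LinearSearch.

Lemma optimal_ratio_ge (R : realType) (s : R) : 1 < s ->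
  ((2 + 1 / s)%:E <= optimal_ratio s)%E.
Proof.
move=> s1; apply: le_ereal_inf_tmp => _ [X zX <-].
apply: (le_trans (ratio_at_ge (d := 2) zX s1 _)); first by lra.
by apply: ereal_sup_ubound; exists 2 => //=; lra.
Qed.

(** * Geometric strategies *)

Section Geometric.
Variables (R : realType) (s r : R).
Hypotheses (s1 : 1 < s) (r1 : 1 < r).
Let X (k : nat) : R := r ^+ k.

Lemma zigzag_strategy_geometric : zigzag_strategy X.
Proof.
have r0 : 0 < r by exact: lt_trans ltr01 r1.
split=> k; first exact: exprn_gt0.
by rewrite ltr_eXn2l.
Qed.

(** Everything is expressed through [r ^+ k], the distance already explored on the target's side and
    the infimum of the [d] first reached in this round. *)
Lemma search_time_geometric b d k : 0 < d -> first_reaches X b d k.+2 ->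
  search_time s X b d
  = ((r - r / s + 2 / s * (r ^+ 2 / (r - 1))) * r ^+ k
     - 2 / s / (r - 1) + d)%:E.
Proof.
move=> d0 rk; rewrite (search_time_firstS s zigzag_strategy_geometric d0 rk).
rewrite sum_expr ?gt_eqF// /X !exprS; congr _%:E.
by field; rewrite subr_eq0 !gt_eqF// (lt_trans ltr01 s1).
Qed.

Lemma first_reaches_geometric b d : exists k, first_reaches X b d k.
Proof.
have [n dn] := expr_unbounded d r1.
(* If round [n] is on the wrong side, the next one is on the right side and goes farther. *)
pose m := if goes_right n == b then n else n.+1.
apply: (@first_reaches_ex _ _ _ _ m); rewrite /reaches /m {m}.
case: ifPn => [-> /=|nb]; first exact: ltW.
apply/andP; split.
  by move: nb; rewrite /goes_right /=; case: (odd n); case: b.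
by apply: le_trans (ltW dn) _; rewrite /X ler_eXn2l.
Qed.

Lemma competitive_ratio_geometric :
  competitive_ratio s X
  = (1 + (r - r / s + 2 / s * (r ^+ 2 / (r - 1))))%:E.
Proof.
set A := r - r / s + _.
have r0 : 0 < r by exact: lt_trans ltr01 r1.
have rm1 : 0 < r - 1 by rewrite subr_gt0.
have s0 : 0 < s^-1 by rewrite invr_gt0 (lt_trans ltr01 s1).
have s1' : s^-1 < 1 by rewrite invf_lt1 ?(lt_trans ltr01 s1).
have c0 : 0 < 2 / s / (r - 1) by rewrite !divr_gt0// (lt_trans ltr01 s1).
have zX := zigzag_strategy_geometric.
(* A target found in round 1 costs [1 + 1/s + d]; the bound also gives [0 < A], used to replace
   [r ^+ k] by [d] in later rounds. *)
have A1 : 1 + s^-1 <= A.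
  have : 1 <= r ^+ 2 / (r - 1) by rewrite ler_pdivlMr//; nra.
  rewrite /A; set q := _ / (r - 1) => q1; nra.
apply/eqP; rewrite eq_le; apply/andP; split.
  apply: ge_ereal_sup => _ [d /= d1 <-].
  have d0 : 0 < d by lra.
  rewrite ratio_atE// lee_pdivrMr_EFin//.
  suff H b : (search_time s X b d <= ((1 + A) * d)%:E)%E by rewrite ge_max !H.
  have [[|[|k]] rk] := first_reaches_geometric b d.
  - by case: rk => /andP[_]; rewrite /X expr0 leNgt d1.
  - rewrite (search_time_firstS s zX d0 rk) big_ord1 /X expr0 lee_fin; nra.
  - rewrite (search_time_geometric d0 rk) -/A lee_fin.
    have : X k < d by rewrite -(exploredSS zX) (explored_lt_first d0 rk).
    rewrite /X; set y := r ^+ k; nra.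
apply/lee_addgt0Pr => e e0.
(* Targets just beyond the turning point [r ^+ n] are the worst ones; the
   overshoot [r - 1] is bounded, hence negligible as [n] grows. *)
have [n Hn] := expr_unbounded ((A * (r - 1) + 2 / s / (r - 1)) / e) r1.
move: Hn; rewrite ltr_pdivrMr// => Hn.
have rn1 : 1 <= r ^+ n by apply: exprn_ege1; exact: ltW.
pose d := r ^+ n + (r - 1).
have d1 : 1 < d by rewrite /d -[ltLHS]addr0 ler_ltD.
have d0 : 0 < d by lra.
(* Since [1 <= r ^+ n], [d] lies between [r ^+ n] and [r ^+ n.+1]: round [n] just misses it and
   round [n.+1] is on the other side. *)
have rk : first_reaches X (goes_right n) d n.+2.
  split.
    rewrite /reaches /goes_right /= negbK eqxx /= /d /X !exprS.
    apply: (@le_trans _ _ (r * r ^+ n)); last first.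
      by rewrite ler_pM2l// ler_peMl ?ltW// exprn_gt0.
    by move: rm1 rn1; set y := r ^+ n => rm1 rn1; nra.
  move=> j; rewrite /reaches negb_and -ltNge ltnS leq_eqVlt => /orP[/eqP ->|jn].
    by rewrite /goes_right /=; case: odd.
  apply/orP; right; apply: (@le_lt_trans _ _ (r ^+ n)); last by rewrite /d; lra.
  by rewrite /X ler_eXn2l.
apply: (@le_trans _ _ (ratio_at s X d + e%:E)%E); last first.
  by rewrite leeD2r//; apply: ereal_sup_ubound; exists d.
rewrite -leeBlDr// -EFinB ratio_atE// lee_pdivlMr_EFin//.
suff : (((1 + A - e) * d)%:E <= search_time s X (goes_right n) d)%E.
  by rewrite le_max; case: (goes_right n) => ->//; rewrite orbT.
rewrite (search_time_geometric d0 rk) -/A lee_fin /d.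
(* The left side exceeds the right by [A (r - 1) + c - e y - e (r - 1)], negative by the choice of
   [n]. *)
move: rn1 Hn; set y := r ^+ n; set c := _ / (r - 1) => y1 Hn; nra.
Qed.

End Geometric.

Unset Implicit Arguments.

(** * The optimized ratio in closed form *)

Theorem theorem3 (R : realType) (s : R) (hs : 1 < s) :
  let r : R := 1 + Num.sqrt (2 / (s + 1)) in
  let X : nat -> R := fun k => r ^+ k in
  [/\ ((2 + 1 / s)%:E <= optimal_ratio s)%E,
      (optimal_ratio s <= competitive_ratio s X)%E
    & competitive_ratio s X
      = (2 + 1 / s * (3 + 2 * Num.sqrt (2 * s + 2)))%:E].
Proof.
move=> r X.
have t0 : 0 < Num.sqrt (2 / (s + 1)) by rewrite sqrtr_gt0 divr_gt0//; lra.
have r1 : 1 < r by rewrite /r; lra.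
split; first exact: optimal_ratio_ge.
  by apply: ereal_inf_lbound; exists X => //; exact: zigzag_strategy_geometric.
rewrite competitive_ratio_geometric//; congr _%:E; rewrite /r.
have sqrt_t : Num.sqrt (2 * s + 2) = (s + 1) * Num.sqrt (2 / (s + 1)).
  have -> : 2 * s + 2 = (s + 1) ^+ 2 * (2 / (s + 1)).
    by field; apply/eqP; lra.
  by rewrite sqrtrM ?sqr_ge0// sqrtr_sqr ger0_norm//; lra.
have t2 : (s + 1) * Num.sqrt (2 / (s + 1)) ^+ 2 = 2.
  by rewrite sqr_sqrtr ?divr_ge0//; [field; apply/eqP|..]; lra.
rewrite sqrt_t; move: t0 t2; set t := Num.sqrt _ => t0 t2.
(* Eliminating [s] turns the claim into a rational identity in [t]; its denominator [2 - t ^+ 2] is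
   [s * t ^+ 2], hence nonzero. *)
have -> : s = 2 / t ^+ 2 - 1 by rewrite -t2; field; apply/eqP; lra.
field; have -> : 2 + -1 * t ^+ 2 = s * t ^+ 2 by rewrite -t2; ring.
by rewrite mulf_neq0 ?expf_neq0 ?gt_eqF// (lt_trans ltr01 hs).
Qed.
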